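(* Let $\mathcal{B}=(e_n)_{n=1}^\infty$ be a conditional almost greedy basis of a Banach space $\mathbb{X}$. Then there are a bijection $\pi:\mathbb{N}\to\mathbb{N}$ and $x\in\mathbb{X}$ such that $$\sup_{m\in\mathbb{N},\,G_m(x)}\ \frac{\|x-G_m(x)\|}{\widehat{\widehat{\sigma}}_m[\mathcal{B}_\pi](x)}\ =\ \infty,$$ where the supremum is over all $m\in\mathbb{N}$ and all greedy sums $G_m(x)$ of $x$ of order $m$. Therefore, the reordered basis $\mathcal{B}_\pi=(e_{\pi(n)})_{n=1}^\infty$ is strong partially greedy but is not super-strong partially greedy.
   Context: Spaces are separable and infinite-dimensional over $\mathbb{F}=\mathbb{R}$ or $\mathbb{C}$. Basis: a collection $\mathcal{B}=(e_n)_{n=1}^\infty\subset\mathbb{X}$ is a (semi-normalized) basis if (1) the closed linear span of $(e_n)$ is $\mathbb{X}$; (2) there is a unique sequence $(e_n^* )_{n=1}^\infty\subset\mathbb{X}^*$ with $e_j^*(e_k)=\delta_{j,k}$; (3) $0<\inf_n\{\|e_n\|,\|e_n^*\|\}\le\sup_n\{\|e_n\|,\|e_n^*\|\}<\infty$. (It need not be a Schauder basis.) The basis is unconditional if there is $\mathbf{K}>0$ such that for all $N$, $\|\sum_{n=1}^Na_ne_n\|\le\mathbf{K}\|\sum_{n=1}^Nb_ne_n\|$ whenever $|a_n|\le|b_n|$ for $1\le n\le N$; it is conditional if it is not unconditional. For finite $A\subset\mathbb{N}$, $P_A(x):=\sum_{n\in A}e_n^*(x)e_n$; $S_m(x):=\sum_{n=1}^me_n^*(x)e_n$,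 $S_0(x):=0$. A set $A\subset\mathbb{N}$ is an $m$-greedy set of $x$ if $|A|=m$ and $\min_{n\in A}|e_n^*(x)|\ge\max_{n\notin A}|e_n^*(x)|$; the corresponding greedy sum of order $m$ is $G_m(x):=P_A(x)$ (not necessarily unique). The collection of greedy sums of $x$ is unchanged under reordering of the basis. The basis is almost greedy if there is $\mathbf{C}\ge1$ with $\|x-G_m(x)\|\le\mathbf{C}\inf\{\|x-P_A(x)\|: |A|=m\}$ for all $x\in\mathbb{X}$, $m\in\mathbb{N}$ and all $G_m(x)$. The basis is strong partially greedy if there is $\mathbf{C}>0$ with $\|x-G_m(x)\|\le\mathbf{C}\min_{0\le n\le m}\|x-S_n(x)\|$ for all $x\in\mathbb{X}$, $m\in\mathbb{N}$ and all $G_m(x)$. For a basis $\mathcal{B}=(e_n)$, $\widehat{\widehat{\sigma}}_m[\mathcal{B}](x):=\inf\{\|x-\sum_{n\in A}a_ne_n\|: A\subset\{1,\dots,m\},\ a_n\in\mathbb{F}\ (n\in A)\}$. The basis is super-strong partially greedy if there is $\mathbf{C}>0$ with $\|x-G_m(x)\|\le\mathbf{C}\,\widehat{\widehat{\sigma}}_m[\mathcal{B}](x)$ for all $x\in\mathbb{X}$, $m\in\mathbb{N}$ and all $G_m(x)$. For the reordered basis $\mathcal{B}_\pi=(e_{\pi(n)})_{n}$ all these notions are taken with respect to the new ordering, e.g. $\widehat{\widehat{\sigma}}_m[\mathcal{B}_\pi](x)=\inf\{\|x-\sum_{n\in A}a_ne_{\pi(n)}\|: A\subset\{1,\dots,m\},\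 a_n\in\mathbb{F}\}$. *)

(* Defs.v *)
From HB Require Import structures.
From mathcomp Require Import all_boot all_order all_algebra finmap.
From mathcomp Require Import complex.
From mathcomp Require Import all_classical all_reals all_analysis.

Set Implicit Arguments.
Unset Strict Implicit.
Unset Printing Implicit Defensive.

Import Order.TTheory GRing.Theory Num.Theory.
Import numFieldNormedType.Exports.
Local Open Scope classical_set_scope.
Local Open Scope ring_scope.

Variant scalar_field (R : realType) := RealScalars | ComplexScalars.

Definition scalars (R : realType) (F : scalar_field R) : numFieldType :=
  match F with
  | RealScalars => R
  | ComplexScalars => R[i]
  end.

Coercion scalars : scalar_field >-> numFieldType.

Definition real_part (R : realType) (F : scalar_field R) : F -> R :=
  match F return scalars F -> R with
  | RealScalars => fun z => z
  | ComplexScalars => fun z => complex.Re z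
  end.

(* In a [normedModType F], [`|v|] is an element of [F], a nonnegative real one;
   [rnorm v] is the same number seen in [R]. *)
Definition rnorm (R : realType) (F : scalar_field R) (V : normedModType F)
  (v : V) : R := real_part `|v|.

Definition rabs (R : realType) (F : scalar_field R) (z : F) : R :=
  real_part `|z|.

Definition dual_norm (R : realType) (F : scalar_field R) (X : normedModType F)
    (f : X -> F) : \bar R :=
  ereal_sup [set (rabs (f x))%:E | x in [set x : X | rnorm x <= 1]].

Definition linear_span (R : realType) (F : scalar_field R)
    (X : normedModType F) (e : nat -> X) : set X :=
  [set x | exists (A : {fset nat}) (a : nat -> F),
             x = \sum_(n <- A) a n *: e n].

Definition biorthogonal (R : realType) (F : scalar_field R)
    (X : normedModType F) (f : nat -> {linear X -> F^o}) (e : nat -> X) :=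
  forall j k, f j (e k) = (j == k)%:R.

(* Sequences are indexed from 0: [bvec n] stands for e_{n+1} and [bcoef n] for
   e*_{n+1}, so the first m vectors are those of index [< m].  The existence of
   such a sequence makes the space separable and infinite-dimensional. *)
Record sn_basis (R : realType) (F : scalar_field R) (X : normedModType F) :=
SnBasis {
  bvec : nat -> X;
  bcoef : nat -> {linear X -> F^o};
  closed_span_vec : closure (linear_span bvec) = setT;
  coef_continuous : forall n, continuous (bcoef n);
  coef_biorthogonal : biorthogonal bcoef bvec;
  coef_unique : forall f : nat -> {linear X -> F^o},
    (forall n, continuous (f n)) -> biorthogonal f bvec ->
    forall n, f n =1 bcoef n;
  semi_normalized_inf :
    (0 < ereal_inf (range (fun n => (rnorm (bvec n))%:E) `|`
                    range (fun n => dual_norm (bcoef n))))%E;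
  semi_normalized_sup :
    (ereal_sup (range (fun n => (rnorm (bvec n))%:E) `|`
                range (fun n => dual_norm (bcoef n))) < +oo)%E
}.

Section Reorder.
Context (R : realType) (F : scalar_field R) (X : normedModType F).
Context (B : sn_basis X) (p : nat -> nat) (p_bij : bijective p).

Lemma range_reorder (T : Type) (g : nat -> T) :
  range (fun n => g (p n)) = range g.
Proof.
have [q pK qK] := p_bij.
apply/seteqP; split => [_ [n _ <-]|_ [n _ <-]]; first by exists (p n).
by exists (q n); rewrite // qK.
Qed.

Lemma linear_span_reorder :
  linear_span (fun n => bvec B (p n)) = linear_span (bvec B).
Proof.
have [q pK qK] := p_bij.
have sub (r s : nat -> nat) (e : nat -> X) : cancel r s ->
    linear_span (fun n => e (r n)) `<=` linear_span e.
  move=> rK _ [A [a ->]].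
  exists [fset r n | n in A]%fset, (fun n => a (s n)).
  rewrite big_imfset /=; last by move=> i j _ _; exact: can_inj rK i j.
  by apply: eq_bigr => i _; rewrite rK.
apply/seteqP; split; first exact: sub pK.
rewrite -[X in linear_span X `<=` _](_ : (fun n => bvec B (p (q n))) = _).
  exact: (sub q p (fun n => bvec B (p n))).
by apply/funext => n; rewrite qK.
Qed.

Lemma closed_span_reorder :
  closure (linear_span (fun n => bvec B (p n))) = setT.
Proof. by rewrite linear_span_reorder closed_span_vec. Qed.

Lemma coef_biorthogonal_reorder :
  biorthogonal (fun n => bcoef B (p n)) (fun n => bvec B (p n)).
Proof. by move=> j k; rewrite coef_biorthogonal (bij_eq p_bij). Qed.

Lemma coef_unique_reorder (f : nat -> {linear X -> F^o}) :
  (forall n, continuous (f n)) -> biorthogonal f (fun n => bvec B (p n)) ->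
  forall n, f n =1 bcoef B (p n).
Proof.
have [q pK qK] := p_bij => fc fb n.
have := @coef_unique _ _ _ B (fun n => f (q n)) (fun n => fc (q n)) _ (p n).
rewrite pK; apply => j k.
by rewrite -[in LHS](qK k) fb (bij_eq (Bijective qK pK)).
Qed.

Lemma semi_normalized_inf_reorder :
  (0 < ereal_inf (range (fun n => (rnorm (bvec B (p n)))%:E) `|`
                  range (fun n => dual_norm (bcoef B (p n)))))%E.
Proof.
rewrite (range_reorder (fun n => (rnorm (bvec B n))%:E)).
rewrite (range_reorder (fun n => dual_norm (bcoef B n))).
exact: semi_normalized_inf.
Qed.

Lemma semi_normalized_sup_reorder :
  (ereal_sup (range (fun n => (rnorm (bvec B (p n)))%:E) `|`
              range (fun n => dual_norm (bcoef B (p n)))) < +oo)%E.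
Proof.
rewrite (range_reorder (fun n => (rnorm (bvec B n))%:E)).
rewrite (range_reorder (fun n => dual_norm (bcoef B n))).
exact: semi_normalized_sup.
Qed.

Definition reorder : sn_basis X :=
  @SnBasis R F X (fun n => bvec B (p n)) (fun n => bcoef B (p n))
    closed_span_reorder (fun n => @coef_continuous _ _ _ B (p n))
    coef_biorthogonal_reorder coef_unique_reorder
    semi_normalized_inf_reorder semi_normalized_sup_reorder.

End Reorder.

Definition unconditional (R : realType) (F : scalar_field R)
    (X : normedModType F) (B : sn_basis X) :=
  exists K : R, 0 < K /\
    forall (N : nat) (a b : nat -> F),
      (forall n, (n < N)%N -> rabs (a n) <= rabs (b n)) ->
      rnorm (\sum_(n < N) a n *: bvec B n) <=
      K * rnorm (\sum_(n < N) b n *: bvec B n).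

Definition conditional (R : realType) (F : scalar_field R)
    (X : normedModType F) (B : sn_basis X) := ~ unconditional B.

Definition coord_proj (R : realType) (F : scalar_field R) (X : normedModType F)
    (B : sn_basis X) (A : {fset nat}) (x : X) : X :=
  \sum_(n <- A) (bcoef B n x : F) *: bvec B n.

Definition partial_sum (R : realType) (F : scalar_field R)
    (X : normedModType F) (B : sn_basis X) (m : nat) (x : X) : X :=
  \sum_(n < m) (bcoef B n x : F) *: bvec B n.

Definition greedy_set (R : realType) (F : scalar_field R)
    (X : normedModType F) (B : sn_basis X) (x : X) (m : nat) (A : {fset nat}) :=
  #|` A| = m /\
  forall i j, i \in A -> j \notin A ->
    rabs (bcoef B j x : F) <= rabs (bcoef B i x : F).

Definition greedy_sum (R : realType) (F : scalar_field R)
    (X : normedModType F) (B : sn_basis X) (x : X) (m : nat) : set X :=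
  [set coord_proj B A x | A in [set A | greedy_set B x m A]].

Definition almost_greedy (R : realType) (F : scalar_field R)
    (X : normedModType F) (B : sn_basis X) :=
  exists C : R, 1 <= C /\
    forall (x : X) (m : nat), (0 < m)%N ->
    forall G, greedy_sum B x m G ->
      rnorm (x - G) <=
      C * inf [set rnorm (x - coord_proj B A x) | A in [set A | #|` A| = m]].

Definition strong_partially_greedy (R : realType) (F : scalar_field R)
    (X : normedModType F) (B : sn_basis X) :=
  exists C : R, 0 < C /\
    forall (x : X) (m : nat), (0 < m)%N ->
    forall G, greedy_sum B x m G ->
      rnorm (x - G) <=
      C * \big[Num.min/rnorm (x - partial_sum B 0 x)]_(n < m.+1)
            rnorm (x - partial_sum B n x).

(* If this is 0 then x is a combination of the first m vectors, so every greedy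
   sum of x of order m is x itself: a quotient by [sigma_hathat] with zero
   denominator is 0 / 0, which is 0 here. *)
Definition sigma_hathat (R : realType) (F : scalar_field R)
    (X : normedModType F) (B : sn_basis X) (m : nat) (x : X) : R :=
  inf [set d | exists (A : {fset nat}) (a : nat -> F),
         (forall n, n \in A -> (n < m)%N) /\
         d = rnorm (x - \sum_(n <- A) a n *: bvec B n)].

Definition super_strong_partially_greedy (R : realType) (F : scalar_field R)
    (X : normedModType F) (B : sn_basis X) :=
  exists C : R, 0 < C /\
    forall (x : X) (m : nat), (0 < m)%N ->
    forall G, greedy_sum B x m G ->
      rnorm (x - G) <= C * sigma_hathat B m x.

(* Main.v *)
Require Import Defs.
From HB Require Import structures.
From mathcomp Require Import all_boot all_order all_algebra finmap.
From mathcomp Require Import complex.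
From mathcomp Require Import all_classical all_reals all_analysis.
From mathcomp Require Import ring lra.

Set Implicit Arguments.
Unset Strict Implicit.
Unset Printing Implicit Defensive.

Import Order.TTheory GRing.Theory Num.Theory.
Import numFieldNormedType.Exports.
Local Open Scope classical_set_scope.
Local Open Scope ring_scope.

(** Write [P_A] for the projection on the coordinates in [A].

    Every reordering of an almost greedy basis is strong partially greedy
    because the partial sums of order [n <= m] of a reordering are projections
    [P_A x] with [#|A| = n <= m].  Since the coefficients of [x] tend to [0],
    [A] can be completed to a set of cardinal [m] at the cost of an arbitrarily
    small error ([almost_greedy_smaller_sets]).

    The order of the basis matters only through the sets formed by its first [m]
    vectors, and these sets can be prescribed.  If [y] is a finite combination
    such that [P_A y] is much larger than [y], and [D] is the rest of the
    support, then adding a huge multiple of the indicator sum of [D] to [y]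
    makes [D] a greedy set.  The greedy remainder is [P_A y], while a combination
    of the vectors in [D] approximates within the norm of [y]; so the ratio is
    large as soon as the vectors of [D] come first in the order.  Such [y] exist
    beyond any given index when the basis is conditional ([conditional_tail]):
    bounds on projections give bounds on multipliers by convexity, and finitely
    many coordinates do not matter.

    A single vector with unbounded ratios is obtained by gliding hump.  The
    integers are cut into consecutive finite blocks, the [k]-th one carrying a
    scaled perturbed vector with ratio at least [k] ([good_block_exists]).  The
    scalings decrease so fast that all the coefficients in a block dominate those
    of the later blocks, and that the tail of the series is negligible with
    respect to the block.  A greedy set is then formed by the earlier blocks and
    the part [D] of the [k]-th one, which is an initial segment for the
    permutation putting in each block the part [D] first
    ([block_permutation]). *)

(** * Norms and moduli as real numbers *)

Definition embed (R : realType) (F : scalar_field R) : R -> F :=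
  match F return R -> scalars F with
  | RealScalars => fun r => r
  | ComplexScalars => fun r => (r%:C)%C
  end.
Arguments embed {R} F.

Section Embed.
Context (R : realType) (F : scalar_field R).

Lemma embedD r s : embed F (r + s) = embed F r + embed F s.
Proof. by case: F => //=; rewrite rmorphD. Qed.

Lemma embedM r s : embed F (r * s) = embed F r * embed F s.
Proof. by case: F => //=; rewrite rmorphM. Qed.

Lemma embed0 : embed F 0 = 0. Proof. by case: F. Qed.

Lemma embed1 : embed F 1 = 1. Proof. by case: F. Qed.

Lemma embedN r : embed F (- r) = - embed F r.
Proof. by case: F => //=; rewrite rmorphN. Qed.

Lemma le_embed r s : (embed F r <= embed F s) = (r <= s).
Proof. by case: F => //=; rewrite lecR. Qed.

Lemma lt_embed r s : (embed F r < embed F s) = (r < s).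
Proof. by case: F => //=; rewrite ltcR. Qed.

Lemma embedK (z : F) : 0 <= z -> embed F (real_part z) = z.
Proof.
case: F z => //= -[a b]; rewrite lecE /= => /andP[/eqP b0 _].
by rewrite b0.
Qed.

Lemma real_part_embed r : real_part (embed F r) = r.
Proof. by case: F. Qed.

Lemma embed_rnorm (V : normedModType F) (v : V) : embed F (rnorm v) = `|v|.
Proof. exact: embedK. Qed.

Lemma embed_rabs (z : F) : embed F (rabs z) = `|z|.
Proof. exact: embedK. Qed.

Lemma rabs_embed r : rabs (embed F r) = `|r|.
Proof.
rewrite /rabs; case: F => //=.
by rewrite expr0n addr0 sqrtr_sqr.
Qed.

End Embed.

Section Norm.
Context (R : realType) (F : scalar_field R) (V : normedModType F).
Implicit Types u v : V.

Lemma rnorm_ge0 v : 0 <= rnorm v.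
Proof. by rewrite -(le_embed F) embed0 embed_rnorm. Qed.

Lemma rnorm0 : rnorm (0 : V) = 0.
Proof. by rewrite /rnorm normr0 -(embed0 F) real_part_embed. Qed.

Lemma rnorm_eq0 v : rnorm v = 0 -> v = 0.
Proof. by move=> v0; apply/normr0_eq0; rewrite -embed_rnorm v0 embed0. Qed.

Lemma rnormN v : rnorm (- v) = rnorm v.
Proof. by rewrite /rnorm normrN. Qed.

Lemma ler_rnormD u v : rnorm (u + v) <= rnorm u + rnorm v.
Proof. by rewrite -(le_embed F) embedD !embed_rnorm ler_normD. Qed.

Lemma ler_rnormB u v : rnorm (u - v) <= rnorm u + rnorm v.
Proof. by rewrite -(rnormN v) ler_rnormD. Qed.

Lemma lerB_rnormD u v : rnorm u - rnorm v <= rnorm (u + v).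
Proof. by rewrite lerBlDr -{1}(addrK v u) ler_rnormB. Qed.

Lemma rnormZ (a : F) v : rnorm (a *: v) = rabs a * rnorm v.
Proof.
by rewrite -[LHS](real_part_embed F) embed_rnorm normrZ -embed_rabs
  -embed_rnorm -embedM real_part_embed.
Qed.

Lemma ler_rnorm_sum (I : Type) (r : seq I) (P : pred I) (f : I -> V) :
  rnorm (\sum_(i <- r | P i) f i) <= \sum_(i <- r | P i) rnorm (f i).
Proof.
elim/big_rec2: _ => [|i y x _ le_xy]; first by rewrite rnorm0.
by rewrite (le_trans (ler_rnormD _ _))// lerD2l.
Qed.

End Norm.

Section Abs.
Context (R : realType) (F : scalar_field R).
Implicit Types a b : F.

Lemma rabs_ge0 a : 0 <= rabs a. Proof. exact: (@rnorm_ge0 _ _ F^o). Qed.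

Lemma rabs_eq0 a : rabs a = 0 -> a = 0. Proof. exact: (@rnorm_eq0 _ _ F^o). Qed.

Lemma rabs0 : rabs (0 : F) = 0. Proof. exact: (@rnorm0 _ _ F^o). Qed.

Lemma lerB_rabsD a b : rabs a - rabs b <= rabs (a + b).
Proof. exact: (@lerB_rnormD _ _ F^o). Qed.

Lemma rabsM a b : rabs (a * b) = rabs a * rabs b.
Proof. exact: (@rnormZ _ _ F^o). Qed.

Lemma rabs_gt0 a : a != 0 -> 0 < rabs a.
Proof.
by rewrite lt_def rabs_ge0 andbT; apply: contraNneq => /rabs_eq0 ->.
Qed.

End Abs.

(** A scalar of modulus at most 1 has real and imaginary parts in [-1, 1], and
    [2 r - 1] runs through [-1, 1] when [r] runs through [0, 1].  The scalar [u]
    is the imaginary unit, or 0 over the reals, so that both fields are treated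
    alike when multipliers are reduced to the interval [0, 1]. *)
Lemma scalar_convex_decomposition (R : realType) (F : scalar_field R) :
  exists u : F, rabs u <= 1 /\ forall z : F, rabs z <= 1 ->
    exists r s : R, [/\ 0 <= r <= 1, 0 <= s <= 1 &
      z = (2 * embed F r - 1) + u * (2 * embed F s - 1)].
Proof.
have half (t : R) : `|t| <= 1 ->
    0 <= (1 + t) / 2 <= 1 /\ 2 * ((1 + t) / 2) - 1 = t.
  rewrite ler_norml => /andP[t1 t2]; split; last by field.
  by apply/andP; split; lra.
case: F => /=.
- exists 0; split; first by rewrite /rabs /= normr0 ler01.
  move=> z; rewrite /rabs /= => /half[h e].
  exists ((1 + z) / 2), 0; split => //; first by rewrite lexx ler01.
  by rewrite e mul0r addr0.
- exists 'i%C; split; first by rewrite /rabs /= expr0n add0r expr1n sqrtr1.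
  move=> -[a b]; rewrite /rabs /= => ab1.
  have le_abs : Num.max `|a| `|b| <= Num.sqrt (a ^+ 2 + b ^+ 2).
    rewrite ge_max -!sqrtr_sqr !ler_sqrt ?addr_ge0 ?sqr_ge0//.
    by rewrite lerDl lerDr !sqr_ge0.
  have := le_trans le_abs ab1; rewrite ge_max.
  move=> /andP[/half[ha ea] /half[hb eb]].
  exists ((1 + a) / 2), ((1 + b) / 2); split => //.
  rewrite -[in LHS]ea -[in LHS]eb.
  by apply/eqP; rewrite eq_complex /=; apply/andP; split; apply/eqP; ring.
Qed.

(** * Coefficients, reorderings and greedy sums *)

Section Basis.
Context (R : realType) (F : scalar_field R) (X : normedModType F).
Implicit Types (B : sn_basis X) (x : X).

Lemma basis_bounded B : exists M : R, [/\ 0 < M,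
  forall n, rnorm (bvec B n) <= M &
  forall n x, rabs (bcoef B n x : F) <= M * rnorm x].
Proof.
have := semi_normalized_sup B; set E := (X in ereal_sup X) => supE.
have [M M0 EM] : exists2 M : R, 0 < M & forall y, E y -> (y <= M%:E)%E.
  exists (Num.max 1 (fine (ereal_sup E))); first by rewrite lt_max ltr01.
  move=> y Ey; have := ereal_sup_ubound Ey => /le_trans; apply.
  have : (-oo < ereal_sup E)%E.
    have E0 : E (rnorm (bvec B 0))%:E by left; exists 0%N.
    by rewrite (lt_le_trans _ (ereal_sup_ubound E0))// ltNyr.
  move: supE; case: (ereal_sup E) => //= r _ _.
  by rewrite lee_fin le_max lexx orbT.
exists M; split => //.
- by move=> n; rewrite -lee_fin; apply: EM; left; exists n.
- move=> n x; have [->|x0] := eqVneq x 0.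
    by rewrite linear0 rabs0 rnorm0 mulr0.
  have nx0 : 0 < rnorm x.
    by rewrite lt_def rnorm_ge0 andbT; apply: contraNneq x0 => /rnorm_eq0 ->.
  have : (dual_norm (bcoef B n) <= M%:E)%E by apply: EM; right; exists n.
  move=> /(le_trans (ereal_sup_ubound _)).
  move=> /(_ (rabs (bcoef B n (embed F (rnorm x)^-1 *: x) : F))%:E).
  rewrite lee_fin linearZ /= -[X in rabs X]/(_ * _) rabsM rabs_embed.
  rewrite normfV gtr0_norm// mulrC ler_pdivrMr//; apply.
  exists (embed F (rnorm x)^-1 *: x) => //=.
  by rewrite rnormZ rabs_embed normfV gtr0_norm// mulVf// gt_eqF.
  rewrite linearZ /= -[X in rabs X]/(_ * _) rabsM rabs_embed.
  by rewrite normfV gtr0_norm// mulrC.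
Qed.

Lemma coef_comb B (r : seq nat) (P : pred nat) (a : nat -> F) j : uniq r ->
  (bcoef B j (\sum_(n <- r | P n) a n *: bvec B n) : F) =
  if (j \in r) && P j then a j else 0.
Proof.
move=> ur; rewrite linear_sum /=.
under eq_bigr => n _ do
  rewrite linearZ /= coef_biorthogonal -[_ *: _]/(a n * (j == n)%:R).
case: ifPn => [/andP[jr Pj]|]; last first.
  rewrite negb_and => h; rewrite big_seq_cond big1// => n /andP[nr Pn].
  by case: eqP h => [->|]; rewrite ?mulr0// nr Pn.
rewrite -big_filter (bigD1_seq j) ?filter_uniq ?mem_filter ?Pj//= eqxx mulr1.
rewrite big1 ?addr0// => n nj.
by rewrite eq_sym (negbTE nj) mulr0.
Qed.

(** The coefficient functionals are uniformly bounded, and each vector of the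
    dense linear span has finitely many nonzero coefficients. *)
Lemma coef_vanish B x (eps : R) : 0 < eps ->
  exists N, forall n, (N <= n)%N -> rabs (bcoef B n x : F) < eps.
Proof.
move=> eps0; have [M [M0 _ coefM]] := basis_bounded B.
have xS : closure (linear_span (bvec B)) x by rewrite closed_span_vec.
have e0 : 0 < embed F (eps / M).
  by rewrite -(embed0 F) lt_embed divr_gt0.
have [_ [[A [a ->]]]] := xS _ (nbhsx_ballx x _ e0).
rewrite -ball_normE /= -embed_rnorm => lt_e.
exists (\max_(i <- A) i).+1 => n An.
have nA : n \notin (A : seq nat).
  by apply: contraL An => nA; rewrite -ltnNge ltnS leq_bigmax_seq.
have -> : (bcoef B n x : F) =
    bcoef B n (x - \sum_(i <- A) a i *: bvec B i).
  by rewrite linearB /= coef_comb ?fset_uniq// (negbTE nA) subr0.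
by rewrite (le_lt_trans (coefM _ _))// mulrC -ltr_pdivlMr// -(lt_embed F).
Qed.

Lemma sum_seq_fset (r : seq nat) (g : nat -> X) : uniq r ->
  \sum_(n <- seq_fset tt r) g n = \sum_(n <- r) g n.
Proof.
by move=> ur; rewrite (perm_big _ (seq_fset_perm tt r)) undup_id.
Qed.

Lemma card_seq_fset (r : seq nat) : uniq r -> #|` seq_fset tt r| = size r.
Proof. by move=> ur; rewrite size_seq_fset undup_id. Qed.

Lemma coord_proj_reorder B p (pb : bijective p) (A : {fset nat}) x :
  coord_proj (reorder B pb) A x = coord_proj B [fset p n | n in A]%fset x.
Proof.
rewrite /coord_proj big_imfset //= => i j _ _.
exact: bij_inj pb i j.
Qed.

(** Greedy sets depend on the moduli of the coefficients and not on their
    positions, so the permutation maps those of one order onto those of the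
    other. *)
Lemma greedy_sum_reorder B p (pb : bijective p) x m :
  greedy_sum (reorder B pb) x m = greedy_sum B x m.
Proof.
have [q pK qK] := pb; have p_inj := can_inj pK; have q_inj := can_inj qK.
apply/seteqP; split => _ [A [Am Ag] <-].
- exists [fset p n | n in A]%fset; last by rewrite coord_proj_reorder.
  split; first by rewrite card_imfset.
  move=> _ j /imfsetP[/= i iA ->] jA.
  have := Ag i (q j) iA; rewrite /= qK; apply.
  by apply: contra jA => jA; rewrite -(qK j) in_imfset.
- have AE : A = [fset p n | n in [fset q n | n in A]]%fset.
    apply/fsetP => n; apply/idP/imfsetP => [nA|[/= _ /imfsetP[/= k kA ->] ->]].
      by exists (q n); rewrite ?qK// in_imfset.
    by rewrite qK.
  exists [fset q n | n in A]%fset; last by rewrite coord_proj_reorder -AE.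
  split; first by rewrite card_imfset.
  move=> _ j /imfsetP[/= i iA ->] jA; rewrite /= qK.
  apply: Ag => //; apply: contra jA => jA.
  by rewrite -(pK j) in_imfset.
Qed.

(** Almost greediness compares a greedy sum of order [m] with projections on
    exactly [m] coordinates; smaller sets are completed with far indices, whose
    coefficients are negligible. *)
Lemma almost_greedy_smaller_sets B : almost_greedy B ->
  exists C : R, 0 < C /\ forall x m G, (0 < m)%N -> greedy_sum B x m G ->
    forall A : {fset nat}, (#|` A| <= m)%N ->
    rnorm (x - G) <= C * rnorm (x - coord_proj B A x).
Proof.
move=> [C [C1 BC]]; have C0 : 0 < C by rewrite (lt_le_trans ltr01).
exists C; split => // x m G m0 xG A Am.
have [M [M0 vecM _]] := basis_bounded B.
apply/ler_addgt0Pr => eps eps0.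
have d0 : 0 < eps / (C * (M * m%:R)).
  by rewrite divr_gt0// !mulr_gt0// ltr0n.
have [N smallN] := coef_vanish B x d0.
(* From [T] on, the indices avoid [A] and the coefficients are tiny. *)
pose T := (N + \max_(i <- A) i).+1.
pose E := seq_fset tt (iota T (m - #|` A|)).
have disj : [disjoint A & E]%fset.
  apply/fdisjointP => i iA; rewrite seq_fsetE mem_iota negb_and.
  apply/orP; left; rewrite -ltnNge /T ltnS.
  by rewrite (leq_trans (leq_bigmax_seq _ iA isT))// leq_addl.
have cardE : #|` E| = (m - #|` A|)%N.
  by rewrite card_seq_fset ?iota_uniq// size_iota.
have cardU : #|` (A `|` E)%fset| = m.
  by rewrite cardfsU (eqP disj) cardfs0 subn0 cardE subnKC.
apply: le_trans (BC x m m0 G xG) _.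
have -> : eps = C * (eps / C) by field; rewrite gt_eqF.
rewrite -mulrDr ler_pM2l//.
have le_inf : inf [set rnorm (x - coord_proj B D x) | D in
    [set D : {fset nat} | #|` D| = m]] <=
    rnorm (x - coord_proj B (A `|` E)%fset x).
  apply: ge_inf; last by exists (A `|` E)%fset.
  by exists 0 => _ [D _ <-]; exact: rnorm_ge0.
apply: le_trans le_inf _.
have -> : coord_proj B (A `|` E)%fset x = coord_proj B A x + coord_proj B E x.
  rewrite /coord_proj -big_cat; apply: perm_big; apply: uniq_perm.
  - exact: fset_uniq.
  - rewrite cat_uniq; apply/and3P; split; try exact: fset_uniq.
    apply/hasPn => i /=; apply: contraL.
    exact: (fdisjointP disj).
  - by move=> i; rewrite mem_cat in_fsetU.
rewrite opprD addrA (le_trans (ler_rnormB _ _))// lerD2l.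
apply: le_trans (ler_rnorm_sum _ _ _) _.
apply: (@le_trans _ _ (\sum_(i <- E) eps / C / m%:R)).
  rewrite big_seq [leRHS]big_seq ler_sum// => i.
  rewrite seq_fsetE mem_iota => /andP[Ti _].
  rewrite rnormZ (@le_trans _ _ (eps / (C * (M * m%:R)) * M))//.
    rewrite ler_pM ?rabs_ge0 ?rnorm_ge0// ltW// smallN//.
    by rewrite (leq_trans _ Ti)// /T leqW// leq_addr.
  rewrite le_eqVlt; apply/orP; left; apply/eqP; field.
  by rewrite !gt_eqF// ltr0n.
rewrite big_const_seq count_predT iter_addr_0 -[size _]/(#|` E|) cardE.
rewrite -[leRHS](@divfK _ m%:R) ?pnatr_eq0 ?gtn_eqF// -[leLHS]mulr_natr.
rewrite ler_wpM2l ?ler_nat ?leq_subr//.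
by rewrite !divr_ge0 ?ler0n// ltW.
Qed.

Lemma almost_greedy_reorder_strong_partially_greedy B p (pb : bijective p) :
  almost_greedy B -> strong_partially_greedy (reorder B pb).
Proof.
move=> /almost_greedy_smaller_sets[C [C0 BC]]; exists C; split => // x m m0 G.
rewrite greedy_sum_reorder => xG.
have le_n n : (n <= m)%N ->
    rnorm (x - G) <= C * rnorm (x - partial_sum (reorder B pb) n x).
  move=> nm; have ur : uniq (map p (iota 0 n)).
    by rewrite map_inj_uniq ?iota_uniq//; exact: bij_inj pb.
  have := BC x m G m0 xG (seq_fset tt (map p (iota 0 n))).
  rewrite card_seq_fset// size_map size_iota => /(_ nm).
  rewrite /coord_proj sum_seq_fset// big_map /partial_sum /=.
  rewrite -(big_mkord predT (fun i => (bcoef B (p i) x : F) *: bvec B (p i))).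
  by rewrite /index_iota subn0.
rewrite -ler_pdivrMl//; elim/big_ind: _ => [|a b ha hb|i _].
- by rewrite ler_pdivrMl// le_n.
- by rewrite le_min ha.
- by rewrite ler_pdivrMl// le_n// -ltnS.
Qed.

(** Coefficient [m] vanishes on all combinations of the first [m] vectors and is
    continuous, so it bounds the distance from below. *)
Lemma sigma_hathat_gt0 B m x :
  (bcoef B m x : F) != 0 -> 0 < sigma_hathat B m x.
Proof.
move=> xm; have [M [M0 _ coefM]] := basis_bounded B.
have lb : 0 < rabs (bcoef B m x : F) / M by rewrite divr_gt0// rabs_gt0.
apply: lt_le_trans lb _; apply: lb_le_inf.
  by exists (rnorm (x - 0)), fset0, (fun=> 0); rewrite big_seq_fset0.
move=> _ [A [a [Am ->]]]; rewrite ler_pdivrMr// mulrC.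
have -> : (bcoef B m x : F) =
    bcoef B m (x - \sum_(i <- A) a i *: bvec B i).
  rewrite linearB /= coef_comb ?fset_uniq//.
  case: ifPn => [/andP[/Am]|_]; first by rewrite ltnn.
  by rewrite subr0.
exact: coefM.
Qed.

End Basis.

(** * Conditional bases have unbounded projections on every tail *)

Section Multipliers.
Context (R : realType) (F : scalar_field R) (X : normedModType F).
Implicit Types (B : sn_basis X) (x : X).

(** The norm is convex in the multipliers, hence bounded on the cube by its
    values at the vertices, which are projections.  The induction turns the
    coordinates into vertices one at a time. *)
Lemma projections_bound_multipliers (e : nat -> X) N (b : nat -> F) (C : R) :
  (forall A : pred nat, rnorm (\sum_(0 <= n < N | A n) b n *: e n) <= C) ->
  forall r : nat -> R, (forall n, 0 <= r n <= 1) ->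
  rnorm (\sum_(0 <= n < N) (embed F (r n) * b n) *: e n) <= C.
Proof.
move=> projC.
suff H k (r : nat -> R) : (forall n, 0 <= r n <= 1) ->
    (forall n, (k <= n < N)%N -> r n = 0 \/ r n = 1) ->
    rnorm (\sum_(0 <= n < N) (embed F (r n) * b n) *: e n) <= C.
  move=> r r01; apply: (H N) => // n.
  by case: ltnP; rewrite ?andbF// leqNgt => ->.
elim: k r => [|k IH] r r01 rk.
  apply: le_trans (projC (fun n => r n == 1)).
  rewrite [in leRHS]big_mkcond /= le_eqVlt; apply/orP; left; apply/eqP.
  congr rnorm; apply: eq_big_nat => n nN; have [->|->] := rk n nN.
    by rewrite embed0 mul0r scale0r eq_sym oner_eq0.
  by rewrite embed1 mul1r eqxx.
pose set_k t n := if n == k then t else r n.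
have splitE : \sum_(0 <= n < N) (embed F (r n) * b n) *: e n =
    embed F (r k) *: (\sum_(0 <= n < N) (embed F (set_k 1 n) * b n) *: e n) +
    embed F (1 - r k) *: (\sum_(0 <= n < N) (embed F (set_k 0 n) * b n) *: e n).
  rewrite !scaler_sumr -big_split /=; apply: eq_bigr => n _.
  rewrite !scalerA -scalerDl; congr (_ *: _).
  rewrite /set_k; case: eqP => [->|_].
    by rewrite embed0 embed1 mul1r mul0r mulr0 addr0.
  by rewrite embedD embedN embed1; ring.
have set_k_le t : t = 0 \/ t = 1 ->
    rnorm (\sum_(0 <= n < N) (embed F (set_k t n) * b n) *: e n) <= C.
  move=> t01; apply: IH => n; rewrite /set_k; case: eqP => // nk.
    by case: t01 => ->; rewrite lexx ler01.
  move=> /andP[kn nN]; apply: rk; rewrite nN andbT ltn_neqAle kn andbT.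
  by apply/eqP => kn'; apply: nk.
have /andP[r0 r1] := r01 k.
rewrite splitE (le_trans (ler_rnormD _ _))// !rnormZ !rabs_embed.
rewrite !ger0_norm ?subr_ge0//.
have -> : C = r k * C + (1 - r k) * C by ring.
by rewrite lerD// ler_wpM2l ?subr_ge0// set_k_le//; [right|left].
Qed.

(** When the moduli of the [a n] are at most those of the [b n], the [a n] are
    the [b n] times multipliers in the unit disc, which are combinations of
    multipliers in [0, 1] with bounded coefficients. *)
Lemma bounded_projections_unconditional B (K : R) : 0 <= K ->
  (forall N (b : nat -> F) (A : pred nat),
    rnorm (\sum_(0 <= n < N | A n) b n *: bvec B n) <=
    K * rnorm (\sum_(0 <= n < N) b n *: bvec B n)) ->
  unconditional B.
Proof.
move=> K0 projK; exists (2 * (2 * K + 1)); split.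
  by rewrite mulr_gt0// ltr_wpDl// mulr_ge0.
move=> N a b le_ab.
rewrite -!(big_mkord predT (fun n => _ n *: bvec B n)).
set y := \sum_(0 <= n < N) b n *: _.
have [u [u1 uP]] := scalar_convex_decomposition F.
pose z n : F := if rabs (a n) <= rabs (b n) then a n / b n else 0.
have aE n : (n < N)%N -> a n = z n * b n.
  move=> /le_ab ab; rewrite /z ab; have [b0|b0] := eqVneq (b n) 0.
    by move: ab; rewrite b0 mulr0 rabs0 => ab; apply: rabs_eq0; apply/eqP;
      rewrite eq_le ab rabs_ge0.
  by rewrite divfK.
have z1 n : rabs (z n) <= 1.
  rewrite /z; case: ifPn => [ab|_]; last by rewrite rabs0 ler01.
  have [b0|b0] := eqVneq (b n) 0; first by rewrite b0 invr0 mulr0 rabs0 ler01.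
  by rewrite -(ler_pM2r (rabs_gt0 b0)) -rabsM divfK// mul1r.
have /choice[rs rsP] : forall n, exists rs : R * R,
    [/\ 0 <= rs.1 <= 1, 0 <= rs.2 <= 1 &
    z n = (2 * embed F rs.1 - 1) + u * (2 * embed F rs.2 - 1)].
  by move=> n; have [r [s h]] := uP _ (z1 n); exists (r, s).
pose T (f : R * R -> R) :=
  \sum_(0 <= n < N) (embed F (f (rs n)) * b n) *: bvec B n.
have TK f : (forall n, 0 <= f (rs n) <= 1) -> rnorm (T f) <= K * rnorm y.
  exact: (projections_bound_multipliers (fun A => projK N b A)).
have -> : \sum_(0 <= n < N) a n *: bvec B n =
    (embed F 2 *: T fst - y) + u *: (embed F 2 *: T snd - y).
  rewrite /T /y !scalerBr !scaler_sumr -!sumrB -big_split /=.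
  apply: eq_big_nat => n /andP[_ nN]; rewrite aE//.
  have [_ _ ->] := rsP n.
  rewrite !scalerA -!scalerBl -scalerDl; congr (_ *: _).
  have -> : embed F 2 = 2 by rewrite (embedD F 1 1) embed1.
  ring.
have part f : (forall n, 0 <= f (rs n) <= 1) ->
    rnorm (embed F 2 *: T f - y) <= (2 * K + 1) * rnorm y.
  move=> f01; rewrite (le_trans (ler_rnormB _ _))// mulrDl mul1r lerD2r.
  by rewrite rnormZ rabs_embed ger0_norm// -mulrA ler_pM2l// TK.
rewrite (le_trans (ler_rnormD _ _))// -mulrA mulr_natl mulr2n lerD//.
  by rewrite part// => n; have [] := rsP n.
rewrite rnormZ -[leRHS]mul1r ler_pM ?rabs_ge0 ?rnorm_ge0//.
by rewrite part// => n; have [] := rsP n.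
Qed.

Lemma finite_part_bound B N0 : exists L : R, 0 <= L /\
  forall N (b : nat -> F) (A : pred nat), (forall n, A n -> (n < N0)%N) ->
  rnorm (\sum_(0 <= n < N | A n) b n *: bvec B n) <=
  L * rnorm (\sum_(0 <= n < N) b n *: bvec B n).
Proof.
have [M [M0 vecM coefM]] := basis_bounded B.
exists (M * M * N0%:R); split; first by rewrite !mulr_ge0 ?ler0n// ltW.
move=> N b A AN0; set y := \sum_(0 <= n < N) _.
have bM n : (n < N)%N -> rabs (b n) <= M * rnorm y.
  move=> nN; suff -> : b n = bcoef B n y by [].
  by rewrite /y coef_comb ?iota_uniq// mem_index_iota nN.
rewrite -big_filter (le_trans (ler_rnorm_sum _ _ _))//.
set r := [seq n <- _ | A n].
apply: (@le_trans _ _ (\sum_(n <- r) M * M * rnorm y)).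
  rewrite big_seq [leRHS]big_seq ler_sum// => n.
  rewrite mem_filter mem_index_iota => /andP[_ nN].
  by rewrite rnormZ mulrAC ler_pM ?rabs_ge0 ?rnorm_ge0// bM.
rewrite big_const_seq count_predT iter_addr_0 -[leLHS]mulr_natr mulrAC.
rewrite ler_wpM2r ?rnorm_ge0// ler_wpM2l ?ler_nat ?mulr_ge0 ?ltW//.
rewrite -[leqRHS](size_iota 0) uniq_leq_size ?filter_uniq ?iota_uniq// => n.
by rewrite mem_filter mem_iota => /andP[/AN0].
Qed.

(** If all the projections were bounded by [K] beyond [N0], then they would be
    bounded everywhere, because the projections on the first [N0] coordinates
    are bounded, and the basis would be unconditional. *)
Lemma conditional_tail B N0 (K : R) : 0 <= K -> conditional B ->
  exists N (b : nat -> F) (A : pred nat),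
    K * rnorm (\sum_(N0 <= n < N) b n *: bvec B n) <
    rnorm (\sum_(N0 <= n < N | A n) b n *: bvec B n).
Proof.
move=> K0 condB; apply: contrapT => H; apply: condB.
have [L [L0 finL]] := finite_part_bound B N0.
apply: (@bounded_projections_unconditional _ (L + K * (1 + L))).
  by rewrite addr_ge0// mulr_ge0// addr_ge0.
move=> N b A; set y := \sum_(0 <= n < N) _.
have tailE (P : pred nat) : \sum_(0 <= n < N | P n) b n *: bvec B n =
    \sum_(0 <= n < N | P n && (n < N0)%N) b n *: bvec B n +
    \sum_(N0 <= n < N | P n) b n *: bvec B n.
  rewrite (bigID (fun n => n < N0)%N) /=; congr (_ + _).
  rewrite (big_nat_widenl N0 0)//; apply: eq_bigl => n.
  by rewrite -leqNgt.
have headL (P : pred nat) :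
    rnorm (\sum_(0 <= n < N | P n && (n < N0)%N) b n *: bvec B n) <=
    L * rnorm y.
  by apply: finL => n /andP[].
rewrite tailE (le_trans (ler_rnormD _ _))// mulrDl lerD//.
apply: (@le_trans _ _ (K * rnorm (\sum_(N0 <= n < N) b n *: bvec B n))).
  by rewrite leNgt; apply/negP => lt; apply: H; exists N, b, A.
rewrite -mulrA ler_wpM2l// mulrDl mul1r.
have -> : \sum_(N0 <= n < N) b n *: bvec B n =
    y - \sum_(0 <= n < N | predT n && (n < N0)%N) b n *: bvec B n.
  by rewrite /y (tailE predT) addrC addKr.
by rewrite (le_trans (ler_rnormB _ _))// lerD2l headL.
Qed.

End Multipliers.

(** * Blocks with a large greedy ratio *)

Section Blocks.
Context (R : realType) (F : scalar_field R) (X : normedModType F).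
Context (B : sn_basis X) (M : R).

(** The indices [N0 <= n < N] carry coefficients [c] whose part outside [A] is
    dominant, and [d] are the coefficients of a good approximation supported
    outside [A].  The number [s] is what the previous blocks allow for everything
    from this block on, and [s'] is what this block allows for everything after
    it: a later vector of norm at most [s'] has coefficients at most [M * s'],
    below all those of the block, and it does not spoil the ratio [k]. *)
Record good_block (k N0 N : nat) (s s' : R) (c d : nat -> F) (A : pred nat) :
    Prop := GoodBlock {
  block_nonempty : (N0 < N)%N;
  slack_gt0 : 0 < s';
  slack_half : s' <= s / 2;
  block_norm : rnorm (\sum_(N0 <= n < N) c n *: bvec B n) <= s / 2;
  block_coef : forall n, (N0 <= n < N)%N -> M * s' <= rabs (c n);
  block_order : forall i j, (N0 <= i < N)%N -> (N0 <= j < N)%N ->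
    A i -> ~~ A j -> rabs (c i) <= rabs (c j);
  block_ratio :
    k%:R * (rnorm (\sum_(N0 <= n < N) c n *: bvec B n -
                   \sum_(N0 <= n < N | ~~ A n) d n *: bvec B n) + s') <=
    rnorm (\sum_(N0 <= n < N | A n) c n *: bvec B n) - s' }.

(** The properties of a block depend only on the coefficients inside it, so the
    data chosen block by block can be glued into global functions. *)
Lemma good_block_local k N0 N s s' c d A c' d' A' :
  (forall n, (N0 <= n < N)%N -> [/\ c n = c' n, d n = d' n & A n = A' n]) ->
  good_block k N0 N s s' c d A -> good_block k N0 N s s' c' d' A'.
Proof.
move=> eq_cdA.
have eq_sum (P P' : pred nat) (f f' : nat -> F) :
    (forall n, (N0 <= n < N)%N -> P n = P' n /\ f n = f' n) ->
    \sum_(N0 <= n < N | P' n) f' n *: bvec B n =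
    \sum_(N0 <= n < N | P n) f n *: bvec B n.
  move=> eqPf; rewrite big_nat_cond [RHS]big_nat_cond.
  apply: eq_big => [n|n /andP[nN _]]; last by have [_ ->] := eqPf n nN.
  by apply: andb_id2l => nN; have [->] := eqPf n nN.
have eqc : \sum_(N0 <= n < N) c' n *: bvec B n =
    \sum_(N0 <= n < N) c n *: bvec B n.
  by apply: eq_sum => n /eq_cdA[].
have eqd : \sum_(N0 <= n < N | ~~ A' n) d' n *: bvec B n =
    \sum_(N0 <= n < N | ~~ A n) d n *: bvec B n.
  by apply: eq_sum => n /eq_cdA[_ -> ->].
have eqA : \sum_(N0 <= n < N | A' n) c' n *: bvec B n =
    \sum_(N0 <= n < N | A n) c n *: bvec B n.
  by apply: eq_sum => n /eq_cdA[-> _ ->].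
case=> h1 h2 h3 h4 h5 h6 h7; split; rewrite ?eqc ?eqd ?eqA//.
- by move=> n nN; have [<- _ _] := eq_cdA n nN; exact: h5.
- move=> i j iN jN; have [<- _ <-] := eq_cdA i iN.
  by have [<- _ <-] := eq_cdA j jN; exact: h6.
Qed.

Lemma finite_positive_lower_bound (r : seq nat) (f : nat -> R) :
  (forall n, n \in r -> 0 < f n) ->
  exists mu : R, 0 < mu /\ forall n, n \in r -> mu <= f n.
Proof.
elim: r => [|a r IH] f0; first by exists 1.
have [n nr|mu [mu0 mur]] := IH; first by rewrite f0// inE nr orbT.
exists (Num.min mu (f a)); split; first by rewrite lt_min mu0 f0// mem_head.
by move=> n; rewrite inE ge_min => /predU1P[->|/mur ->//]; rewrite lexx orbT.
Qed.

(** Start from [y] whose projection [yA] on [A] exceeds [k] times [y] in norm,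
    with the zero coordinates of [y] moved out of [A].  Adding a large constant
    [t] outside [A] makes every coefficient of the block nonzero and those
    outside [A] dominant; scaling by [eps] makes the block small, and [s'] is
    then small with respect to the gap in the ratio inequality and to the
    moduli of the coefficients. *)
Lemma good_block_exists (M0 : 0 < M) (condB : conditional B) k N0 (s : R) :
  0 < s -> exists N s' c d A, good_block k N0 N s s' c d A.
Proof.
move=> s0; have [N [b [A0 lt_bA]]] := conditional_tail N0 (ler0n R k) condB.
have N0N : (N0 < N)%N.
  rewrite ltnNge; apply/negP => NN0.
  by move: lt_bA; rewrite !big_geq// rnorm0 mulr0 ltxx.
(* Coefficients equal to 0 must receive the constant as well, so that no
   coefficient of the block vanishes. *)
pose A n := A0 n && (b n != 0).
have eqA : \sum_(N0 <= n < N | A0 n) b n *: bvec B n =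
    \sum_(N0 <= n < N | A n) b n *: bvec B n.
  rewrite big_mkcond [RHS]big_mkcond /=; apply: eq_bigr => n _; rewrite /A.
  by case: (A0 n) => //=; case: eqP => // ->; rewrite scale0r.
rewrite eqA in lt_bA.
set y := (\sum_(N0 <= n < N) b n *: bvec B n) in lt_bA.
set yA := (\sum_(N0 <= n < N | A n) b n *: bvec B n) in lt_bA.
pose S := \sum_(N0 <= n < N) rabs (b n).
have bS n : (N0 <= n < N)%N -> rabs (b n) <= S.
  move=> nN; rewrite /S (bigD1_seq n) ?mem_index_iota ?iota_uniq//=.
  by rewrite lerDl sumr_ge0// => i _; exact: rabs_ge0.
have S0 : 0 <= S by rewrite sumr_ge0// => i _; exact: rabs_ge0.
(* Then [t - S >= S + 1], which exceeds every modulus [rabs (b n)]. *)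
pose t := 2 * S + 1.
pose c' n : F := if A n then b n else b n + embed F t.
have c'_big n : (N0 <= n < N)%N -> ~~ A n -> S + 1 <= rabs (c' n).
  move=> nN An; rewrite /c' (negbTE An) [b n + _]addrC.
  rewrite (le_trans _ (lerB_rabsD _ _))//.
  rewrite rabs_embed ger0_norm ?addr_ge0 ?mulr_ge0//.
  by have := bS n nN; rewrite /t; lra.
have c'_gt0 n : (N0 <= n < N)%N -> 0 < rabs (c' n).
  move=> nN; have [An|An] := boolP (A n).
    by rewrite /c' An rabs_gt0//; case/andP: An.
  by rewrite (lt_le_trans _ (c'_big n nN An))// ltr_wpDl.
have nc'0 : 0 <= rnorm (\sum_(N0 <= n < N) c' n *: bvec B n).
  exact: rnorm_ge0.
pose eps := s / 2 / (1 + rnorm (\sum_(N0 <= n < N) c' n *: bvec B n)).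
have eps0 : 0 < eps by rewrite !divr_gt0// ltr_wpDr.
pose c n := embed F eps * c' n.
have rabs_c n : rabs (c n) = eps * rabs (c' n).
  by rewrite rabsM rabs_embed gtr0_norm.
have scale (P : pred nat) (f : nat -> F) :
    \sum_(N0 <= n < N | P n) (embed F eps * f n) *: bvec B n =
    embed F eps *: \sum_(N0 <= n < N | P n) f n *: bvec B n.
  by rewrite scaler_sumr; apply: eq_bigr => n _; rewrite scalerA.
have rnorm_scale (v : X) : rnorm (embed F eps *: v) = eps * rnorm v.
  by rewrite rnormZ rabs_embed gtr0_norm.
have [|mu [mu0 muP]] :=
  @finite_positive_lower_bound (index_iota N0 N) (fun n => rabs (c n)).
  by move=> n; rewrite mem_index_iota => nN; rewrite rabs_c mulr_gt0// c'_gt0.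
pose gap := rnorm yA - k%:R * rnorm y.
have gap0 : 0 < gap by rewrite subr_gt0.
pose s' := Num.min (s / 2) (Num.min (eps * gap / (k%:R + 1)) (mu / M)).
have k0 : 0 < k%:R + 1 :> R by rewrite ltr_wpDl.
have s's : s' <= s / 2 by rewrite ge_min lexx.
have s'g : s' <= eps * gap / (k%:R + 1) by rewrite !ge_min lexx orbT.
have s'm : s' <= mu / M by rewrite !ge_min lexx !orbT.
exists N, s', c, (fun=> embed F eps * embed F t), A; split => //.
- by rewrite !lt_min !divr_gt0// mulr_gt0.
- rewrite scale rnorm_scale /eps mulrAC ler_pdivrMr ?ltr_wpDr//.
  by rewrite ler_pM2l ?divr_gt0// lerDr.
- move=> n nN; apply: le_trans (muP n _); last by rewrite mem_index_iota.
  by rewrite mulrC -ler_pdivlMr.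
- move=> i j iN jN Ai Aj; rewrite !rabs_c ler_pM2l//.
  apply: le_trans (c'_big j jN Aj); rewrite /c' Ai.
  by rewrite (le_trans (bS i iN))// lerDl.
- rewrite !scale -scalerBr.
  have -> : \sum_(N0 <= n < N | A n) c' n *: bvec B n = yA.
    by apply: eq_bigr => n An; rewrite /c' An.
  have -> : \sum_(N0 <= n < N) c' n *: bvec B n -
      \sum_(N0 <= n < N | ~~ A n) embed F t *: bvec B n = y.
    rewrite [X in _ - X]big_mkcond -sumrB; apply: eq_bigr => n _; rewrite /c'.
    by case: (A n); rewrite /= ?subr0// scalerDl addrK.
  rewrite !rnorm_scale.
  move: s'g; rewrite ler_pdivlMr// /gap => s'g.
  by rewrite -subr_ge0; move: s'g; rewrite -subr_ge0; congr (0 <= _); ring.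
Qed.

End Blocks.

(** * Partitions of the integers into intervals *)

Section Partition.
Context (E : nat -> nat) (E0 : E 0 = 0%N) (E_incr : forall k, (E k < E k.+1)%N).

Lemma endpoints_le k l : (k <= l)%N -> (E k <= E l)%N.
Proof. exact: (homo_leq (leqnn) leq_trans (fun k => ltnW (E_incr k))). Qed.

Lemma leq_endpoint k : (k <= E k)%N.
Proof. by elim: k => // k IH; exact: leq_ltn_trans IH (E_incr k). Qed.

Lemma block_index : exists blk : nat -> nat,
  forall n k, (blk n == k) = (E k <= n < E k.+1)%N.
Proof.
have ex n : exists k, (n < E k.+1)%N by exists n; exact: leq_endpoint.
exists (fun n => ex_minn (ex n)) => n k.
case: ex_minnP => m nm m_min; apply/eqP/andP => [<-|[kn nk]].
  split=> //; case: m m_min {nm} => [|m] m_min; first by rewrite E0.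
  by rewrite leqNgt; apply/negP => /m_min; rewrite ltnn.
apply/eqP; rewrite eqn_leq m_min//= leqNgt; apply/negP => mk.
by have := leq_trans nm (endpoints_le mk); rewrite ltnNge kn.
Qed.

(** In each block the indices outside [A] are listed before those in [A]: [p]
    reads this list and [q] gives positions in it.  Hence initial segments of
    the new order can consist of full blocks and of the part of the next one
    outside [A]. *)
Lemma block_permutation (A : pred nat) : exists p q : nat -> nat,
  [/\ cancel p q, cancel q p,
      forall k n, (n < E k)%N -> (q n < E k)%N &
      forall k n, (E k <= n < E k.+1)%N -> ~~ A n ->
        (q n < E k + count (predC A) (index_iota (E k) (E k.+1)))%N].
Proof.
have [blk blkP] := block_index.
pose ord k := [seq n <- index_iota (E k) (E k.+1) | predC A n] ++
              [seq n <- index_iota (E k) (E k.+1) | A n].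
have permE k : perm_eq (ord k) (index_iota (E k) (E k.+1)).
  by rewrite /ord perm_catC perm_filterC.
have size_ord k : size (ord k) = (E k.+1 - E k)%N.
  by rewrite (perm_size (permE k)) size_iota.
have mem_ord k n : (n \in ord k) = (E k <= n < E k.+1)%N.
  by rewrite (perm_mem (permE k)) mem_index_iota.
have uniq_ord k : uniq (ord k) by rewrite (perm_uniq (permE k)) iota_uniq.
have blk_in n : (E (blk n) <= n < E (blk n).+1)%N by rewrite -blkP.
have blk_eq n k : (E k <= n < E k.+1)%N -> blk n = k by rewrite -blkP => /eqP.
pose p n := nth 0%N (ord (blk n)) (n - E (blk n)).
pose q n := (E (blk n) + index n (ord (blk n)))%N.
have lt_sub n : (n - E (blk n) < size (ord (blk n)))%N.
  rewrite size_ord; have /andP[h1 h2] := blk_in n.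
  by rewrite ltn_sub2r// (leq_ltn_trans h1).
have blk_p n : blk (p n) = blk n.
  by apply: blk_eq; rewrite -mem_ord mem_nth.
have index_lt n : (index n (ord (blk n)) < E (blk n).+1 - E (blk n))%N.
  by rewrite -size_ord index_mem mem_ord.
have q_in n : (E (blk n) <= q n < E (blk n).+1)%N.
  by rewrite /q leq_addr /= -ltn_subRL.
have blk_q n : blk (q n) = blk n by apply: blk_eq.
exists p, q; split.
- move=> n; rewrite /q blk_p /p index_uniq//.
  by rewrite subnKC//; case/andP: (blk_in n).
- move=> n; rewrite /p blk_q /q addKn nth_index// mem_ord.
  exact: blk_in.
- move=> k n nk; have /andP[h1 _] := blk_in n; have /andP[_ h2] := q_in n.
  apply: leq_trans h2 _; apply: endpoints_le.
  rewrite ltnNge; apply/negP => /endpoints_le h.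
  by have := leq_ltn_trans (leq_trans h h1) nk; rewrite ltnn.
- move=> k n nk An; rewrite /q (blk_eq _ _ nk) ltn_add2l /ord index_cat.
  rewrite mem_filter /= An mem_index_iota nk /= -size_filter index_mem.
  by rewrite mem_filter /= An mem_index_iota.
Qed.

End Partition.

(** * The gliding hump *)

Section Glue.
Context (R : realType) (F : scalar_field R) (X : normedModType F).

Lemma good_blocks_exist (B : sn_basis X) (M : R) : 0 < M -> conditional B ->
  exists (E : nat -> nat) (s : nat -> R) (c d : nat -> F) (A : pred nat),
  [/\ E 0 = 0%N, 0 < s 0 &
      forall k, good_block B M k (E k) (E k.+1) (s k) (s k.+1) c d A].
Proof.
move=> M0 condB.
pose T := (nat * R * (nat -> F) * (nat -> F) * (pred nat))%type.
(* The components of [T] are [N], [s'], [c], [d] and [A]. *)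
have step (w : nat * T) : exists w' : T, 0 < w.2.1.1.1.2 ->
    good_block B M w.1 w.2.1.1.1.1 w'.1.1.1.1 w.2.1.1.1.2 w'.1.1.1.2
      w'.1.1.2 w'.1.2 w'.2.
  have [s0|s0] := ltP 0 w.2.1.1.1.2; last by exists w.2.
  have [N [s' [c [d [A h]]]]] :=
    good_block_exists M0 condB w.1 w.2.1.1.1.1 s0.
  by exists (N, s', c, d, A).
have [next nextP] := choice step.
pose W := fix W k : T := if k is k'.+1 then next (k', W k')
  else (0%N, 1, fun=> 0, fun=> 0, xpred0).
have s_gt0 k : 0 < (W k).1.1.1.2.
  by elim: k => [|k IH]; [exact: ltr01|exact: slack_gt0 (nextP (k, W k) IH)].
have WP k := nextP (k, W k) (s_gt0 k).
pose E k := (W k).1.1.1.1.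
have E_incr k : (E k < E k.+1)%N := block_nonempty (WP k).
have [blk blkP] := block_index (erefl : E 0 = 0%N) E_incr.
exists E, (fun k => (W k).1.1.1.2), (fun n => (W (blk n).+1).1.1.2 n),
  (fun n => (W (blk n).+1).1.2 n), (fun n => (W (blk n).+1).2 n).
split; [by []|exact: s_gt0|].
move=> k; apply: good_block_local (WP k) => n.
by rewrite -blkP => /eqP ->.
Qed.

End Glue.

Lemma halving_lt (R : realType) (s : nat -> R) :
  (forall k, 0 < s k) -> (forall k, s k.+1 <= s k / 2) ->
  forall eps, 0 < eps -> exists K, forall k, (K <= k)%N -> s k < eps.
Proof.
move=> s0 s_half eps eps0.
have le k : s k * k.+1%:R <= s 0.
  elim: k => [|k IH]; first by rewrite mulr1.
  apply: le_trans IH; apply: (@le_trans _ _ (s k / 2 * k.+2%:R)).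
    by rewrite ler_wpM2r.
  rewrite -mulrA ler_pM2l// ler_pdivrMl// -natrM ler_nat mul2n -addnn.
  by rewrite !addSn !addnS !ltnS leq_addr.
exists (Num.truncn (s 0 / eps)).+1 => k Kk.
rewrite -(@ltr_pM2r _ k.+1%:R)// (le_lt_trans (le k))// mulrC -ltr_pdivrMr//.
by rewrite (lt_le_trans (truncnS_gt _))// ler_nat (leq_trans Kk).
Qed.

(** The slack [s k] bounds the whole tail after stage [k], as the steps are
    dominated by a geometric series of ratio 1/2 starting at [s k / 2]. *)
Lemma halving_limit (R : realType) (F : scalar_field R)
    (X : completeNormedModType F) (u : nat -> X) (s : nat -> R) :
  (forall k, 0 < s k) -> (forall k, s k.+1 <= s k / 2) ->
  (forall k, rnorm (u k.+1 - u k) <= s k / 2) ->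
  exists x, forall k, rnorm (x - u k) <= s k.
Proof.
move=> s0 s_half u_half.
have far i k : rnorm (u (k + i)%N - u k) <= s k.
  elim: i k => [|i IH] k; first by rewrite addn0 subrr rnorm0 ltW.
  rewrite addnS -addSn -(subrKA (u k.+1)) (le_trans (ler_rnormD _ _))//.
  by have := IH k.+1; have := u_half k; have := s_half k; lra.
have cu : cvg (u @ \oo).
  apply/cauchy_cvgP/cauchy_exP => e e0.
  have e1 : 0 < real_part e by rewrite -(lt_embed F) embed0 embedK// ltW.
  have [K KP] := halving_lt s0 s_half e1.
  exists (u K); exists K => // n /= Kn; rewrite -ball_normE /=.
  rewrite -embed_rnorm -(embedK (ltW e0)) lt_embed.
  by rewrite -rnormN opprB -(subnKC Kn) (le_lt_trans (far _ _))// KP.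
exists (lim (u @ \oo)) => k; apply/ler_addgt0Pr => e e0.
have e0' : 0 < embed F e by rewrite -(embed0 F) lt_embed.
have [N _ NP] := (cvgrPdist_lt _ _).1 cu _ e0'.
have := NP (maxn N k) (leq_maxl _ _).
rewrite -embed_rnorm lt_embed => /ltW lt_e.
rewrite -(subrKA (u (maxn N k))) (le_trans (ler_rnormD _ _))// addrC lerD//.
by rewrite -(subnKC (leq_maxr N k)) far.
Qed.

(** The gliding hump: [x] is the sum of all the blocks.  For the [k]-th ratio, [r]
    lists the earlier blocks and the dominant part of block [k]; it is a greedy
    set of [x] and the initial segment of length [size r] of the reordering.
    Without it, [x] reduces to the part [zA] of block [k] plus a tail of norm at
    most [s k.+1], whereas replacing the coefficients [c] by [d] on the dominant
    part gives a far better approximation. *)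
Lemma unbounded_greedy_ratio (R : realType) (F : scalar_field R)
    (X : completeNormedModType F) (B : sn_basis X) : conditional B ->
  exists (p : nat -> nat) (p_bij : bijective p) (x : X),
  forall k, (0 < k)%N -> exists (m : nat) (G : X),
    [/\ (0 < m)%N, greedy_sum B x m G,
        0 < sigma_hathat (reorder B p_bij) m x &
        k%:R * sigma_hathat (reorder B p_bij) m x <= rnorm (x - G)].
Proof.
move=> condB; have [M [M0 _ coefM]] := basis_bounded B.
have [E [s [c [d [A [E0 s00 blocks]]]]]] := good_blocks_exist M0 condB.
have E_incr k : (E k < E k.+1)%N := block_nonempty (blocks k).
have s_gt0 k : 0 < s k by case: k => // k; exact: slack_gt0 (blocks k).
have s_half k : s k.+1 <= s k / 2 := slack_half (blocks k).
have [blk blkP] := block_index E0 E_incr.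
have [p [q [pK qK q_lt q_block]]] := block_permutation E0 E_incr A.
have p_bij : bijective p by exists q.
pose u k := \sum_(0 <= n < E k) c n *: bvec B n.
have uS k : u k.+1 = u k + \sum_(E k <= n < E k.+1) c n *: bvec B n.
  by rewrite -big_cat_nat// ltnW.
have u_half k : rnorm (u k.+1 - u k) <= s k / 2.
  by rewrite uS addrC addKr; exact: block_norm (blocks k).
have [x x_u] := halving_limit s_gt0 s_half u_half.
have coef_u k n : (bcoef B n (u k) : F) = if (n < E k)%N then c n else 0.
  by rewrite /u coef_comb ?iota_uniq// mem_index_iota andbT.
have coef_tail k n : rabs (bcoef B n x - bcoef B n (u k) : F) <= M * s k.
  have -> : (bcoef B n x - bcoef B n (u k) : F) = bcoef B n (x - u k).
    by rewrite linearB.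
  by rewrite (le_trans (coefM _ _))// ler_pM2l.
have coef_x n : (bcoef B n x : F) = c n.
  apply/eqP; rewrite -subr_eq0; apply/eqP/rabs_eq0/eqP.
  rewrite eq_le rabs_ge0 andbT leNgt; apply/negP => gap.
  have [K sK] := halving_lt s_gt0 s_half (divr_gt0 gap M0).
  pose k := maxn K n.+1.
  have := sK k (leq_maxl _ _); rewrite ltNge ler_pdivrMr// mulrC.
  move=> /negP; apply.
  have := coef_tail k n; rewrite coef_u.
  by rewrite (leq_trans (leq_maxr _ _ : n < k)%N)// leq_endpoint.
have c_large k n : (E k <= n < E k.+1)%N -> M * s k.+1 <= rabs (c n).
  exact: block_coef (blocks k) n.
have c_neq0 n : c n != 0.
  have /andP[h1 h2] : (E (blk n) <= n < E (blk n).+1)%N by rewrite -blkP.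
  apply: contraTneq (c_large (blk n) n _) => [->|]; last by rewrite h1.
  by rewrite rabs0 -ltNge mulr_gt0.
have c_decr i j k : (i < E k)%N -> (E k <= j)%N -> rabs (c j) <= rabs (c i).
  move=> ik kj.
  have iB : (E (blk i) <= i < E (blk i).+1)%N by rewrite -blkP.
  apply: le_trans (c_large _ _ iB); apply: le_trans (coef_tail (blk i).+1 j).
  rewrite coef_u coef_x ltnNge.
  rewrite (leq_trans _ kj) ?subr0// (endpoints_le E_incr)//.
  rewrite ltnNge; apply/negP => /(endpoints_le E_incr) h.
  have /andP[h1 _] := iB.
  by have := leq_ltn_trans (leq_trans h h1) ik; rewrite ltnn.
exists p, p_bij, x => k k0.
pose D := [seq n <- index_iota (E k) (E k.+1) | ~~ A n].
pose r := iota 0 (E k) ++ D.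
have mem_r n : (n \in r) = (n < E k)%N || (~~ A n && (E k <= n < E k.+1))%N.
  by rewrite mem_cat mem_iota mem_filter mem_index_iota.
have ur : uniq r.
  rewrite cat_uniq iota_uniq filter_uniq ?iota_uniq// andbT.
  apply/hasPn => n; rewrite mem_filter mem_index_iota mem_iota /= add0n.
  by rewrite -leqNgt => /and3P[].
have size_r : size r = (E k + count (predC A) (index_iota (E k) (E k.+1)))%N.
  by rewrite size_cat size_iota size_filter.
have sum_r (f : nat -> X) : \sum_(n <- r) f n =
    \sum_(0 <= n < E k) f n + \sum_(E k <= n < E k.+1 | ~~ A n) f n.
  by rewrite big_cat big_filter /index_iota subn0.
pose zA := \sum_(E k <= n < E k.+1 | A n) c n *: bvec B n.
have blockE : \sum_(E k <= n < E k.+1) c n *: bvec B n =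
    zA + \sum_(E k <= n < E k.+1 | ~~ A n) c n *: bvec B n.
  by rewrite (bigID A).
exists (size r), (coord_proj B (seq_fset tt r) x); split.
- rewrite size_r (leq_trans k0)// (leq_trans (leq_endpoint E_incr k))//.
  exact: leq_addr.
- exists (seq_fset tt r) => //; split; first exact: card_seq_fset.
  move=> i j; rewrite !seq_fsetE !mem_r !coef_x negb_or -leqNgt.
  move=> ir /andP[kj jr]; case/orP: ir => [ik|/andP[Ai iB]].
    exact: c_decr ik kj.
  have [kj1|jk1] := leqP (E k.+1) j.
    by apply: c_decr kj1; case/andP: iB.
  move: jr; rewrite kj jk1 /= andbT negbK => Aj.
  by apply: block_order (blocks k) _ _ _ iB Aj Ai; rewrite kj.
- by apply: sigma_hathat_gt0; rewrite /= coef_x.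
- have -> : x - coord_proj B (seq_fset tt r) x = (x - u k.+1) + zA.
    rewrite /coord_proj sum_seq_fset//.
    under eq_bigr do rewrite coef_x.
    rewrite sum_r uS blockE -/(u k) [zA + _]addrC addrA.
    by rewrite [in RHS]opprD [in RHS]addrA subrK.
  rewrite addrC (le_trans _ (lerB_rnormD _ _))//.
  apply: le_trans (_ : rnorm zA - s k.+1 <= _); last by rewrite lerD2l lerN2.
  apply: le_trans (block_ratio (blocks k)).
  rewrite ler_wpM2l ?ler0n//.
  pose w n := if (n < E k)%N then c n else d n.
  have w_sum : \sum_(n <- r) w n *: bvec B n = u k +
      \sum_(E k <= n < E k.+1 | ~~ A n) d n *: bvec B n.
    rewrite sum_r; congr (_ + _).
      by apply: eq_big_nat => n /andP[_ nk]; rewrite /w nk.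
    rewrite big_nat_cond [RHS]big_nat_cond; apply: eq_bigr => n.
    by case/andP=> /andP[kn _] _; rewrite /w ltnNge kn.
  apply: le_trans (_ : rnorm (x - \sum_(n <- r) w n *: bvec B n) <= _).
    apply: ge_inf; first by exists 0 => _ [? [? [_ ->]]]; exact: rnorm_ge0.
    exists (seq_fset tt (map q r)), (fun i => w (p i)); split.
      move=> i; rewrite seq_fsetE => /mapP[n nr ->].
      rewrite size_r; move: nr; rewrite mem_r => /orP[nk|/andP[An nB]].
        by rewrite (leq_trans (q_lt _ _ nk))// leq_addr.
      exact: q_block.
    rewrite sum_seq_fset ?map_inj_uniq//; last exact: can_inj qK.
    by rewrite big_map /=; under [in RHS]eq_bigr do rewrite qK.
  have -> : x - \sum_(n <- r) w n *: bvec B n = (x - u k.+1) +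
      (\sum_(E k <= n < E k.+1) c n *: bvec B n -
       \sum_(E k <= n < E k.+1 | ~~ A n) d n *: bvec B n).
    by rewrite w_sum uS opprD addrA opprD addrA addrA subrK.
  by rewrite (le_trans (ler_rnormD _ _))// addrC lerD2l.
Qed.

Unset Implicit Arguments.

Theorem theorem2p12 (R : realType) (F : scalar_field R)
    (X : completeNormedModType F) (B : sn_basis X)
    (B_conditional : conditional B) (B_almost_greedy : almost_greedy B) :
  exists (p : nat -> nat) (p_bij : bijective p),
    (exists x : X,
       ereal_sup [set r : \bar R | exists (m : nat) (G : X),
         (0 < m)%N /\ greedy_sum B x m G /\
         r = (rnorm (x - G) / sigma_hathat (reorder B p_bij) m x)%:E] = +oo%E) /\
    strong_partially_greedy (reorder B p_bij) /\
    ~ super_strong_partially_greedy (reorder B p_bij).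
Proof.
have [p [p_bij [x ratio]]] := unbounded_greedy_ratio B_conditional.
exists p, p_bij; split; [|split].
- exists x; set Q := (X in ereal_sup X).
  have natQ k : (0 < k)%N -> (k%:R%:E <= ereal_sup Q)%E.
    move=> k0; have [m [G [m0 xG sig0 le_sig]]] := ratio k k0.
    apply: le_trans (ereal_sup_ubound (_ : Q _)); last by exists m, G.
    by rewrite lee_fin ler_pdivlMr.
  apply: eq_infty => r; apply: le_trans (natQ (Num.truncn r).+1 isT).
  by rewrite lee_fin ltW// truncnS_gt.
- exact: almost_greedy_reorder_strong_partially_greedy.
- move=> [C [C0 BC]].
  have [m [G [m0 xG sig0 le_sig]]] := ratio (Num.truncn C).+1 isT.
  have := BC x m m0 G; rewrite greedy_sum_reorder => /(_ xG).
  apply/negP; rewrite -ltNge; apply: lt_le_trans le_sig.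
  by rewrite ltr_pM2r// truncnS_gt.
Qed.
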